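(* For every $\delta\in(0,1)$ there is a constant $c(\delta)>0$, depending only on $\delta$, such that the following holds. Let $G$ be a compact abelian group with normalized Haar measure, and suppose that the distinct characters $\gamma_1,\dots,\gamma_N\in\widehat G$ belong to a Sidon set with constant $S$. Then for every $n\le(1-\delta)N$, $$ d_n^{\mathbb C}(\{\gamma_1,\dots,\gamma_N\},L_1(G))\ \ge\ \frac{c(\delta)}{S}. $$
   Context: A finite set $\Lambda=\{\lambda_1,\dots,\lambda_M\}\subset\widehat G$ of distinct characters is a Sidon set with constant $S$ if $$\sum_{j=1}^M|a_j|\le S\left\|\sum_{j=1}^M a_j\lambda_j\right\|_{C(G)}$$ for all complex coefficients $a_1,\dots,a_M$, where $\|\cdot\|_{C(G)}$ is the sup norm. The complex Kolmogorov width is $$ d_n^{\mathbb C}(\{f_1,\dots,f_N\},X):=\inf_{\dim_{\mathbb C} V\le n}\ \max_{1\le k\le N}\operatorname{dist}_{X}(f_k,V),$$ the infimum being over complex linear subspaces $V\subset X$ of dimension at most $n$. $L_1(G)$ is taken with respect to the Haar probability measure. *)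

(* Defs.v *)
From HB Require Import structures.
From mathcomp Require Import all_boot all_order all_algebra.
From mathcomp Require Import complex.
From mathcomp Require Import all_classical all_reals all_analysis.

Set Implicit Arguments.
Unset Strict Implicit.
Unset Printing Implicit Defensive.

Import Order.TTheory GRing.Theory Num.Theory.
Import numFieldNormedType.Exports.
Import complex.ComplexField.Normc.

Local Open Scope classical_set_scope.
Local Open Scope ring_scope.

(* Abelian groups are written additively ([topologicalZmodType]), and C is the
   type [R[i]] of complex numbers over an arbitrary [R : realType], with
   [normc z : R] the modulus of z. *)

(* An alias of G carrying the Borel sigma-algebra. It is needed because a
   [measurableType] must be pointed. *)
Definition borel (G : topologicalZmodType) : Type := G.

HB.instance Definition _ (G : topologicalZmodType) :=
  Choice.copy (borel G) G.
HB.instance Definition _ (G : topologicalZmodType) :=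
  isPointed.Build (borel G) (0 : G).
HB.instance Definition _ (G : topologicalZmodType) :=
  Measurable.copy (borel G)
    (g_sigma_algebraType (@open G : set (set (borel G)))).

(* On a compact Hausdorff group this is the usual characterization of the
   normalized Haar measure as the regular translation-invariant Borel
   probability measure. *)
Definition is_haar (R : realType) (G : topologicalZmodType)
    (mu : probability (borel G) R) : Prop :=
  [/\ forall (x : G) (A : set (borel G)), measurable A ->
        mu [set x + a | a in (A : set G)] = mu A,
      forall A : set (borel G), measurable A ->
        mu A = ereal_inf [set mu U | U in [set U : set G | open U /\ A `<=` U]]
    & forall U : set G, open U ->
        mu U =
          ereal_sup [set mu K | K in [set K : set G | compact K /\ K `<=` U]]].

(* The dual group of G: continuous homomorphisms into the unit circle. The
   type [R[i]^o] is [R[i]] with the topology of its norm. *)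
Definition character (R : realType) (G : topologicalZmodType) :
    set (G -> R[i]) :=
  [set chi | [/\ continuous (chi : G -> R[i]^o),
                 forall x, normc (chi x) = 1
               & forall x y, chi (x + y) = chi x * chi y]].

Definition sup_norm (R : realType) (G : topologicalZmodType)
    (f : G -> R[i]) : R :=
  sup [set normc (f x) | x in [set: G]].

Definition sidon (R : realType) (G : topologicalZmodType) (M : nat)
    (lambda : 'I_M -> G -> R[i]) (S : R) : Prop :=
  [/\ forall j, character (lambda j),
      injective lambda
    & forall a : 'I_M -> R[i],
        \sum_(j < M) normc (a j) <=
          S * sup_norm (fun x => \sum_(j < M) a j * lambda j x)].

Section KolmogorovWidth.
Context (R : realType) (G : topologicalZmodType).
Variable mu : probability (borel G) R.

(* Elements of the complex space L_1(mu) are handled through representatives: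
   [L1] is the set of integrable functions, and equality in L_1 is equality
   mu-almost everywhere. *)
Definition L1 : set (G -> R[i]) :=
  [set f | mu.-integrable [set: borel G]
             (fun x : borel G => (complex.Re (f x))%:E) /\
           mu.-integrable [set: borel G]
             (fun x : borel G => (complex.Im (f x))%:E)].

Definition L1_norm (f : G -> R[i]) : \bar R :=
  (\int[mu]_x (normc (f x))%:E)%E.

Definition L1_subspace (V : set (G -> R[i])) : Prop :=
  [/\ V `<=` L1,
      V (fun=> 0)
    & forall (a : R[i]) (f g : G -> R[i]),
        V f -> V g -> V (fun x => a * f x + g x)].

(* V, read in L_1, is spanned by at most n of its elements. *)
Definition L1_dim_le (V : set (G -> R[i])) (n : nat) : Prop :=
  exists b : 'I_n -> G -> R[i],
    (forall i, V (b i)) /\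
    forall f, V f -> exists a : 'I_n -> R[i],
      {ae mu, forall x, f x = \sum_(i < n) a i * b i x}.

Definition L1_dist (f : G -> R[i]) (V : set (G -> R[i])) : \bar R :=
  ereal_inf [set L1_norm (fun x => f x - v x) | v in V].

(* [-oo] is the neutral element of [maxe]; it plays no role when 0 < N. *)
Definition kolmogorov_width (n N : nat) (f : 'I_N -> G -> R[i]) : \bar R :=
  ereal_inf [set (\big[maxe/-oo]_(k < N) L1_dist (f k) V)%E
            | V in [set V | L1_subspace V /\ L1_dim_le V n]].

End KolmogorovWidth.

(* Main.v *)
Require Import Defs.
From mathcomp Require Import all_boot all_order all_algebra.
From mathcomp Require Import complex.
From mathcomp Require Import all_classical all_reals all_analysis.
From mathcomp Require Import measurable_realfun.
From mathcomp Require Import ring lra zify.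
Import Order.TTheory GRing.Theory Num.Theory.
Import numFieldNormedType.Exports.
Import complex.ComplexField.Normc.
Set Implicit Arguments.
Unset Strict Implicit.
Unset Printing Implicit Defensive.
Local Open Scope classical_set_scope.
Local Open Scope ring_scope.

(* Suppose functions g_k in the span of b_1, ..., b_n approximate the gamma_k
   in L_1 within c/S. By duality, the Sidon inequality interpolates every
   bounded sequence (w_k) by values (nu^(gamma_k)) of finitely supported
   measures nu of mass O(S). Convolving gamma_k - g_k with such a nu gives an
   error O(c), and at each fixed point x the vector (w_k gamma_k(x))_k is then
   compared with a vector of a subspace of C^N of dimension at most n which does
   not depend on w. Averaging over all w in the grid {0, ..., q-1}^(2N) (real and
   imaginary parts) reduces the theorem to the finite statement that, for q large
   in terms of delta, the grid is on average l_1-far from every subspace of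
   dimension at most (1-delta) times that of the ambient space. For this, round
   the vectors of the subspace to the grid: by the Sauer-Shelah lemma there are
   at most q^d e^K roundings (d the dimension, K the number of coordinates),
   each l_1-close to only C^K of the q^K grid points. *)

(** * Shattering, the Sauer-Shelah lemma and the number of roundings *)

Section Shattering.
Import boot.fintype boot.finset.

Definition shatters (X : finType) (F : {set {set X}}) (A : {set X}) : bool :=
  [forall B : {set X}, (B \subset A) ==> [exists P in F, P :&: A == B]].

Lemma shattersS (X : finType) (F F' : {set {set X}}) (A : {set X}) :
  F \subset F' -> shatters F A -> shatters F' A.
Proof.
move=> /subsetP FF' /forallP sA; apply/forallP => B; apply/implyP => BA.
have /existsP[P /andP[PF PA]] := implyP (sA B) BA.
by apply/existsP; exists P; rewrite FF'.
Qed.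

(* Pajor's form of the Sauer-Shelah lemma. *)
Lemma card_shatters (X : finType) (F : {set {set X}}) :
  (#|F| <= #|[set A | shatters F A]|)%N.
Proof.
have [k] := ubnP #|F|; elim: k F => // k IHk F ltFk.
case: (leqP #|F| 1) => [F1|/card_gt1P[P [Q [PF QF PQ]]]].
  have [->|/set0Pn[P PF]] := eqVneq F set0; first by rewrite cards0.
  apply: (leq_trans F1); rewrite card_gt0; apply/set0Pn; exists set0.
  rewrite inE; apply/forallP => B; apply/implyP; rewrite subset0 => /eqP ->.
  by apply/existsP; exists P; rewrite PF setI0 eqxx.
have [x xPQ] : exists x, (x \in P) != (x \in Q).
  apply/existsP; apply: contraNT PQ; rewrite negb_exists => /forallP PQ.
  by apply/eqP/setP => x; have := PQ x; rewrite negbK => /eqP.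
pose F1 := [set D in F | x \in D]; pose F0 := [set D in F | x \notin D].
have FE : (#|F1| + #|F0| = #|F|)%N.
  rewrite -(cardsID [set D : {set X} | x \in D] F); congr (_ + _)%N; apply: eq_card => D;
  by rewrite !inE // andbC.
have [F1_gt0 F0_gt0] : (0 < #|F1|)%N /\ (0 < #|F0|)%N.
  split; rewrite card_gt0; apply/set0Pn; move: xPQ;
  case xP: (x \in P); case xQ: (x \in Q) => // _.
  - by exists P; rewrite inE PF.
  - by exists Q; rewrite inE QF.
  - by exists Q; rewrite inE QF xQ.
  - by exists P; rewrite inE PF xP.
(* Every set in [S1] or [S0] avoids [x], since [F1] is constant at [x] and so is [F0]. A set in both
   stays shattered by [F] after adding [x], so the sets counted twice in [#|S1| + #|S0|] are paid
   for by new ones. *)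
pose S1 := [set A | shatters F1 A]; pose S0 := [set A | shatters F0 A].
have xS1 A : A \in S1 -> x \notin A.
  rewrite inE => /forallP/(_ set0)/implyP; rewrite sub0set => /(_ isT).
  case/existsP => D /andP[]; rewrite inE => /andP[_ xD] /eqP DA.
  by apply/negP => xA; have := in_set0 x; rewrite -DA inE xD xA.
have xS0 A : A \in S0 -> x \notin A.
  rewrite inE => sA; apply/negP => xA.
  move/forallP: sA => /(_ [set x])/implyP; rewrite sub1set => /(_ xA).
  case/existsP => D /andP[]; rewrite inE => /andP[_ /negP xD] /eqP DA.
  by apply: xD; have := set11 x; rewrite -DA inE => /andP[].
have disj : (S1 :|: S0) :&: [set x |: A | A in S1 :&: S0] = set0.
  apply/setP => A; rewrite in_setI in_set0; apply/negbTE; rewrite negb_and.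
  case: (boolP (A \in S1 :|: S0)) => //=; rewrite in_setU => AS.
  apply/imsetP => -[B _ AB].
  by case/orP: AS => [/xS1|/xS0]; rewrite AB setU11.
have imcard : #|[set x |: A | A in S1 :&: S0]| = #|S1 :&: S0|.
  apply: card_in_imset => A B; rewrite !in_setI => /andP[/xS1 xA _] /andP[/xS1 xB _] AB.
  by rewrite -(setU1K xA) AB setU1K.
have sub : (S1 :|: S0) :|: [set x |: A | A in S1 :&: S0] \subset
           [set A | shatters F A].
  apply/subsetP => A; rewrite in_setU => /orP[|/imsetP[B]].
    by rewrite !inE => /orP[]; apply: shattersS; apply/subsetP => D;
       rewrite inE => /andP[].
  rewrite in_setI => /andP[BS1 BS0] ->.
  have xB := xS1 _ BS1.
  move: BS1 BS0; rewrite !inE => /forallP B1 /forallP B0.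
  apply/forallP => C; apply/implyP => CxB.
  have CB : C :\ x \subset B by rewrite subDset.
  case xC: (x \in C).
    have /existsP[D /andP[]] := implyP (B1 _) CB.
    rewrite inE => /andP[DF xD] /eqP DB.
    apply/existsP; exists D; rewrite DF; apply/eqP.
    by rewrite setIUr DB (setIidPr _) ?sub1set// setD1K.
  have /existsP[D /andP[]] := implyP (B0 _) CB.
  rewrite inE => /andP[DF xD] /eqP DB.
  apply/existsP; exists D; rewrite DF; apply/eqP.
  rewrite setIUr DB; apply/setP => z; rewrite !inE.
  have [->|] := eqVneq z x; first by rewrite xC (negbTE xD).
  by rewrite andbF.
apply: leq_trans (subset_leq_card sub).
rewrite cardsU disj cards0 subn0 imcard cardsUI -FE leq_add//.
  by apply: IHk; move: ltFk F0_gt0; rewrite -FE; lia.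
by apply: IHk; move: ltFk F1_gt0; rewrite -FE; lia.
Qed.

(** The subgraph of [u] over the grid. Its fibre over [i] has as many elements as the ceiling of
    [u i] clipped to [[0, q]], so this set encodes the rounding of [u], and shattering applies to
    roundings. *)
Definition levels (R : realType) (I : finType) (q : nat) (u : I -> R) :
  {set I * 'I_q} := [set p : I * 'I_q | p.2%:R < u p.1].

(* A linear dependency y between the rows of a indexed by A would give the sum of
   y_p (u_p - s_p) a value independent of u; the subsets of A on which y is
   positive, resp. negative, force opposite signs on it. *)
Lemma card_shattered_levels (R : realType) (I J : finType) (q : nat)
    (a : I -> J -> R) (F : {set {set I * 'I_q}}) (A : {set I * 'I_q}) :
  (forall P, P \in F ->
     exists h : J -> R, P = levels q (fun i => \sum_j a i j * h j)) ->
  shatters F A -> (#|A| <= #|J|)%N.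
Proof.
move=> FE sA; rewrite leqNgt; apply/negP => JA.
pose e (k : 'I_#|A|) : I * 'I_q := enum_val k.
pose M : 'M[R]_(#|A|, #|J|) :=
  \matrix_(k, j) a (e k).1 (enum_val j).
have key (y : 'rV[R]_#|A|) : y *m M = 0 ->
    \sum_k y 0 k * (e k).2%:R <= 0 /\
    ((exists k, 0 < y 0 k) -> \sum_k y 0 k * (e k).2%:R < 0).
  move=> yM.
  pose B := [set e k | k in [pred k | 0 < y 0 k]].
  have BA : B \subset A.
    by apply/subsetP => p /imsetP[k _ ->]; exact: enum_valP.
  have /existsP[P /andP[PF /eqP PA]] := implyP (forallP sA B) BA.
  have [h Ph] := FE _ PF.
  set u := fun i => _ in Ph.
  have uP k : ((e k).2%:R < u (e k).1) = (0 < y 0 k).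
    transitivity (e k \in P :&: A).
      by rewrite in_setI enum_valP andbT Ph inE.
    rewrite PA; apply/imsetP/idP => [[l]|yk]; last by exists k.
    by rewrite inE => yl /enum_val_inj ->.
  have u0 : \sum_k y 0 k * u (e k).1 = 0.
    under eq_bigr do rewrite /u big_distrr/=.
    rewrite exchange_big/= big1// => j _.
    transitivity ((y *m M) 0 (enum_rank j) * h j); last by rewrite yM mxE mul0r.
    rewrite mxE big_distrl/=; apply: eq_bigr => k _.
    by rewrite !mxE enum_rankK mulrA.
  have -> : \sum_k y 0 k * (e k).2%:R =
      - \sum_k (y 0 k * u (e k).1 - y 0 k * (e k).2%:R).
    by rewrite sumrB u0 sub0r opprK.
  rewrite oppr_le0 oppr_lt0.
  have ge0 k : 0 <= y 0 k * u (e k).1 - y 0 k * (e k).2%:R.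
    rewrite -mulrBr; case: (ltP 0 (y 0 k)) => yk.
      by apply: mulr_ge0; [exact: ltW|rewrite subr_ge0 ltW// uP].
    by apply: mulr_le0; rewrite // subr_le0 leNgt uP -leNgt.
  split; first by apply: sumr_ge0 => k _.
  case=> k yk; rewrite (bigD1 k)//=; apply: ltr_wpDr; first exact: sumr_ge0.
  by rewrite -mulrBr mulr_gt0// subr_gt0 uP.
have : kermx M != 0.
  rewrite -mxrank_eq0 mxrank_ker -lt0n subn_gt0.
  exact: leq_ltn_trans (rank_leq_col _) JA.
case/rowV0Pn => y /sub_kermxP yM y0.
have [k yk] : exists k, y 0 k != 0.
  apply/existsP; apply: contraNT y0; rewrite negb_exists => /forallP y0.
  by apply/eqP/rowP => k; rewrite mxE; apply/eqP; have := y0 k; rewrite negbK.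
have NyM : - y *m M = 0 by rewrite mulNmx yM oppr0.
have [y1 y2] := key _ yM; have [z1 z2] := key _ NyM.
have zE : \sum_k (- y) 0 k * (e k).2%:R =
          - \sum_k y 0 k * (e k).2%:R.
  by rewrite -sumrN; apply: eq_bigr => l _; rewrite mxE mulNr.
rewrite zE in z1 z2.
have [yk0|yk0|yk0] := ltgtP (y 0 k) 0; last by rewrite yk0 eqxx in yk.
  have /z2 : exists k, 0 < (- y) 0 k by exists k; rewrite mxE oppr_gt0.
  lra.
have /y2 : exists k, 0 < y 0 k by exists k.
lra.
Qed.

Lemma sum_expr_card (R : comNzRingType) (X : finType) (x : R) :
  \sum_(A : {set X}) x ^+ #|A| = (1 + x) ^+ #|X|.
Proof.
rewrite addrC -prodr_const bigA_distr; apply: eq_bigr => A _.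
by rewrite -prodr_const big_mkcond.
Qed.

(** There are at most as many roundings as shattered sets [A], and these have at most [#|J|]
    elements. So each has weight [q ^+ #|J| * q^-1 ^+ #|A|] at least 1, and the weights of all sets
    add up to [q ^+ #|J| * (1 + q^-1) ^+ (q * #|I|)]. *)
Lemma card_levels (R : realType) (I J : finType) (q : nat)
    (a : I -> J -> R) (F : {set {set I * 'I_q}}) : (0 < q)%N ->
  (forall P, P \in F ->
     exists h : J -> R, P = levels q (fun i => \sum_j a i j * h j)) ->
  #|F|%:R <= q%:R ^+ #|J| * expR #|I|%:R :> R.
Proof.
move=> q0 FE; have q0R : 0 < q%:R :> R by rewrite ltr0n.
apply: (@le_trans _ _ (#|[set A | shatters F A]|%:R)).
  by rewrite ler_nat card_shatters.
apply: (@le_trans _ _ (q%:R ^+ #|J| * (1 + q%:R^-1) ^+ #|{: I * 'I_q}|)).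
  rewrite -sum_expr_card mulr_sumr -sum1_card natr_sum big_mkcond/=.
  apply: ler_sum => A _; case: ifPn => [|_]; last first.
    by rewrite mulr_ge0// exprn_ge0// ?invr_ge0 ler0n.
  rewrite inE => /(card_shattered_levels FE) AJ.
  rewrite exprVn -(subnK AJ) exprD mulfK ?expf_neq0 ?gt_eqF//.
  by rewrite exprn_ege1// ler1n.
rewrite ler_wpM2l ?exprn_ge0// card_prod card_ord mulnC exprM.
rewrite -[X in expR X]mulr1 expRM_natl.
rewrite lerXn2r// ?nnegrE ?expR_ge0// ?exprn_ge0 ?addr_ge0 ?invr_ge0//.
apply: (@le_trans _ _ (expR q%:R^-1 ^+ q)).
  by rewrite lerXn2r// ?nnegrE ?expR_ge0 ?addr_ge0 ?invr_ge0// expR_ge1Dx.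
by rewrite -expRM_natl mulfV ?gt_eqF.
Qed.

(** * Average [l_1] distance from the grid to a subspace *)

Lemma expR1_le4 (R : realType) : expR 1 <= 4 :> R.
Proof.
have h1 : 2^-1 <= expR (- 2^-1) :> R.
  by apply: le_trans (expR_ge1Dx _); lra.
have h2 : expR (2^-1) <= 2 :> R.
  by rewrite -[expR _]invrK -expRN -[leRHS]invrK lef_pV2// posrE ?expR_gt0.
have -> : 4 = 2 * 2 :> R by lra.
have -> : expR 1 = expR (2^-1) * expR (2^-1) :> R.
  by rewrite -expRD; congr expR; lra.
by rewrite ler_pM// expR_ge0.
Qed.

Lemma sum_expR_dist (R : realType) (q v : nat) :
  \sum_(s < q) expR (- `|s%:R - v%:R|) <= 3 :> R.
Proof.
pose e : R := expR (-1).
have e0 : 0 <= e by exact: expR_ge0.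
have e2 : 2 * e <= 1.
  rewrite /e expRN -ler_pdivlMr ?invr_gt0 ?expR_gt0// invrK mul1r.
  by apply: le_trans (expR_ge1Dx 1); lra.
have eX n : expR (- n%:R) = e ^+ n by rewrite -expRM_natl mulrN1.
have E n : 0 <= e ^+ n by rewrite exprn_ge0.
(* As [2 * e <= 1], both geometric tails have explicit bounds that survive induction on [q]: one up
   to [v], one from [v] on. Both equal 1 at [q = v]. *)
suff [H1 H2] : ((q <= v)%N -> \sum_(s < q) expR (- `|s%:R - v%:R|) <= e ^+ (v - q))
  /\ ((v <= q)%N -> \sum_(s < q) expR (- `|s%:R - v%:R|) <= 3 - 2 * e ^+ (q - v)).
  case: (leqP q v) => [/H1 H|/ltnW/H2 H]; apply: (le_trans H).
    by apply: (@le_trans _ _ 1); [rewrite exprn_ile1//; lra|lra].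
  by have := E (q - v)%N; lra.
elim: q => [|q [IH1 IH2]].
  rewrite big_ord0; split=> //; rewrite leqn0 => /eqP ->.
  by rewrite subn0 expr0; lra.
rewrite big_ord_recr/=; split=> [qv|].
  have {}IH1 := IH1 (ltnW qv).
  have -> : expR (- `|q%:R - v%:R|) = e ^+ (v - q).
    by rewrite distrC -natrB ?normr_nat ?eX// ltnW.
  move: IH1; rewrite -(subnSK qv) exprS; set z := e ^+ _.
  have : 0 <= z by exact: E.
  by nra.
rewrite leq_eqVlt => /orP[/eqP vq|].
  have qv : (q <= v)%N by rewrite vq.
  have {qv}IH1 := IH1 qv.
  rewrite vq subnn expr0; rewrite vq subSnn expr1 in IH1.
  have -> : expR (- `|q%:R - q.+1%:R|) = e ^+ 1.
    by rewrite distrC -natrB ?normr_nat ?eX// subSnn.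
  by rewrite expr1; lra.
rewrite ltnS => vq; have {}IH2 := IH2 vq.
have -> : expR (- `|q%:R - v%:R|) = e ^+ (q - v).
  by rewrite -natrB ?normr_nat ?eX.
rewrite subSn// exprS; move: IH2; set z := e ^+ _ => IH2.
have : 0 <= z by exact: E.
by nra.
Qed.

(** The three clauses describe [c] as the ceiling of [u] clipped to [[0, q]]. *)
Lemma level_count (R : realType) (q : nat) (u : R)
    (c := #|[set s : 'I_q | s%:R < u]|) :
  [/\ (c <= q)%N, (c = 0)%N \/ c%:R - 1 < u & c = q \/ u <= c%:R].
Proof.
rewrite {}/c; have -> : #|[set s : 'I_q | s%:R < u]| = (\sum_(s < q) (s%:R < u)%R)%N.
  by rewrite -sum1_card big_mkcond; apply: eq_bigr => s _; rewrite inE; case: ifP.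
elim: q => [|q]; first by rewrite big_ord0; split; [|left|left].
rewrite big_ord_recr/=; set c := (\sum_(_ < _) _)%N => -[cq c0 c1].
case: (ltP q%:R u) => qu; rewrite ?addn0 ?addn1.
  have cE : c = q.
    by case: c1 => // uc; have := lt_le_trans qu uc; rewrite ltr_nat ltnNge cq.
  by split; [rewrite cE|right; rewrite -natr1 cE addrK|left; rewrite cE].
by split=> //; [exact: leqW|right; case: c1 => [->|]].
Qed.

(** Clipping to [[0, q]] does not move [u] away from [w], which lies in that interval, and rounding
    up costs at most 1. *)
Lemma level_count_dist (R : realType) (q : nat) (u : R) (w : 'I_q) :
  `|w%:R - #|[set s : 'I_q | s%:R < u]|%:R| <= `|w%:R - u| + 1.
Proof.
have [] := level_count q u; set c := #|_| => cq c0 c1.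
have [w0 wq] : 0 <= w%:R :> R /\ w%:R <= q%:R - 1 :> R.
  by split; [exact: ler0n|rewrite lerBrDr natr1 ler_nat].
have {}c0 : c%:R = 0 :> R \/ c%:R - 1 < u by case: c0 => [->|]; [left|right].
have {}c1 : c%:R = q%:R :> R \/ u <= c%:R by case: c1 => [->|]; [left|right].
have cqR : c%:R <= q%:R :> R by rewrite ler_nat.
have := ler_norm (w%:R - u); have := ler_norm (- (w%:R - u)); rewrite normrN.
by rewrite ler_norml; case: c0 => c0; case: c1 => c1; lra.
Qed.

(** The three factors are the cost of rounding each approximant, the number of possible roundings,
    and, for one fixed rounding, a product over the coordinates of sums at most 3. *)
Lemma sum_expR_grid_dist (R : realType) (I J : finType) (q : nat)
    (a : I -> J -> R) (h : {ffun I -> 'I_q} -> J -> R) : (0 < q)%N ->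
  \sum_(w : {ffun I -> 'I_q})
     expR (- \sum_i `|(w i)%:R - \sum_j a i j * h w j|) <=
  expR #|I|%:R * (q%:R ^+ #|J| * expR #|I|%:R) * 3 ^+ #|I|.
Proof.
move=> q0; pose P (w : {ffun I -> 'I_q}) :=
  levels q (fun i => \sum_j a i j * h w j).
pose F := [set P w | w in [set: {ffun I -> 'I_q}]].
pose cnt (Q : {set I * 'I_q}) i := #|[set s | (i, s) \in Q]|.
pose W Q (w : {ffun I -> 'I_q}) : R := \prod_i expR (- `|(w i)%:R - (cnt Q i)%:R|).
have W0 Q w : 0 <= W Q w by apply: prodr_ge0 => i _; exact: expR_ge0.
have WP (w : {ffun I -> 'I_q}) : expR (- \sum_i `|(w i)%:R - \sum_j a i j * h w j|) <=
            expR #|I|%:R * W (P w) w.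
  rewrite /W -expR_sum -expRD ler_expR sumrN lerNl opprD opprK addrC lerBlDr.
  rewrite -sum1_card natr_sum -big_split/=; apply: ler_sum => i _.
  rewrite /cnt (_ : [set s | (i, s) \in P w] =
    [set s : 'I_q | s%:R < \sum_j a i j * h w j]); first exact: level_count_dist.
  by apply/setP => s; rewrite !inE.
(* The rounding attached to [w] is replaced by a sum over all roundings, so that [Q] no longer
   depends on [w] and the sum over [w] factorizes. *)
apply: (@le_trans _ _ (\sum_w \sum_(Q in F) expR #|I|%:R * W Q w)).
  apply: ler_sum => w _; rewrite (bigD1 (P w))/=; last exact: imset_f.
  rewrite -[leLHS]addr0 lerD// sumr_ge0// => Q _.
  by rewrite mulr_ge0// expR_ge0.
rewrite exchange_big/=.
apply: (@le_trans _ _ (\sum_(Q in F) expR #|I|%:R * 3 ^+ #|I|)).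
  apply: ler_sum => Q _; rewrite -mulr_sumr ler_wpM2l ?expR_ge0//.
  rewrite /W -(bigA_distr_bigA (fun i (s : 'I_q) => expR (- `|s%:R - (cnt Q i)%:R|))).
  rewrite -prodr_const ler_prod// => i _; rewrite sum_expR_dist andbT.
  by apply: sumr_ge0 => s _; exact: expR_ge0.
rewrite sumr_const -[X in X <= _]mulr_natr -!mulrA ler_wpM2l ?expR_ge0//.
rewrite mulrC mulrA ler_wpM2r ?exprn_ge0//.
apply: card_levels => // Q /imsetP[w _ ->]; by exists (h w).
Qed.

Lemma grid_far_from_span (R : realType) (I J : finType) (q : nat)
    (a : I -> J -> R) (h : {ffun I -> 'I_q} -> J -> R) : (0 < q)%N ->
  (192 ^ #|I| * q ^ #|J| <= q ^ #|I|)%N ->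
  #|I|%:R * q%:R ^+ #|I| <=
    \sum_(w : {ffun I -> 'I_q}) \sum_i `|(w i)%:R - \sum_j a i j * h w j|.
Proof.
(* exp(-D) is bounded below by its tangent at D = #|I|; 192 = 4^3 * 3 with 4
   standing for e. *)
move=> q0 Hq; pose D (w : {ffun I -> 'I_q}) : R := \sum_i `|(w i)%:R - \sum_j a i j * h w j|.
rewrite -[leRHS]/(\sum_w D w).
have DE (w : {ffun I -> 'I_q}) :
    1 + #|I|%:R - D w <= expR #|I|%:R * expR (- D w).
  by rewrite -expRD -addrA; exact: expR_ge1Dx.
have S1 : \sum_(w : {ffun I -> 'I_q}) (1 + #|I|%:R - D w) <= q%:R ^+ #|I|.
  apply: (le_trans (ler_sum _ (fun w _ => DE w))).
  rewrite -mulr_sumr.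
  apply: (le_trans (ler_wpM2l (expR_ge0 _) (sum_expR_grid_dist a h q0))).
  apply: (@le_trans _ _ (192 ^+ #|I| * q%:R ^+ #|J|)); last first.
    by rewrite -!natrX -natrM ler_nat.
  have -> : 192 = 4 * 4 * 4 * 3 :> R by lra.
  have eI : expR #|I|%:R <= 4 ^+ #|I| :> R.
    rewrite -[X in expR X]mulr1 expRM_natl lerXn2r ?nnegrE ?expR_ge0//.
    exact: expR1_le4.
  set E := expR _ in eI *; set Q := _ ^+ #|J|; rewrite !exprMn.
  have -> : E * (E * (Q * E) * 3 ^+ #|I|) = E * E * E * (3 ^+ #|I| * Q) by ring.
  have E0 : 0 <= E by exact: expR_ge0.
  have T0 : 0 <= 3 ^+ #|I| * Q by rewrite mulr_ge0// exprn_ge0.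
  have EE : E * E * E <= 4 ^+ #|I| * 4 ^+ #|I| * 4 ^+ #|I|.
    by rewrite !ler_pM ?mulr_ge0.
  by rewrite -[leRHS]mulrA ler_wpM2r.
move: S1; rewrite sumrB sumr_const card_ffun card_ord -[X in X - _]mulr_natr natrX.
by set N := q%:R ^+ _; rewrite mulrDl mul1r; lra.
Qed.
End Shattering.

(** * Separation from a bounded convex set *)

(** If the squared distance from [b] stayed above [e], a near-minimizer [w] could be improved by
    moving towards a point [p] that is nearly maximal for the functional [y = b - w]. *)
Lemma convex_approx (R : realType) (I : finType) (P : (I -> R) -> Prop)
    (b : I -> R) (M : R) :
  (exists w, P w) ->
  (forall w, P w -> forall i, `|w i| <= M) ->
  (forall s w p, 0 <= s <= 1 -> P w -> P p ->
     P (fun i => (1 - s) * w i + s * p i)) ->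
  (forall (y : I -> R) e, 0 < e ->
     exists2 p, P p & \sum_i y i * b i <= \sum_i y i * p i + e) ->
  forall e, 0 < e -> exists2 w, P w & \sum_i (b i - w i) ^+ 2 <= e.
Proof.
move=> [w0 Pw0] PM Pconv Psup e e0; apply: contrapT => noP.
pose phi (w : I -> R) := \sum_i (b i - w i) ^+ 2.
have phi_gt w : P w -> e < phi w.
  by move=> Pw; rewrite ltNge; apply/negP => H; apply: noP; exists w.
pose A := [set phi w | w in P].
have hA : has_inf A.
  by split; [exists (phi w0), w0|exists e => _ [w Pw <-]; exact/ltW/phi_gt].
have infA w : P w -> inf A <= phi w.
  by move=> Pw; apply: ge_inf; [exact: hA.2|exists w].
pose M2 : R := \sum_(i in I) (2 * M) ^+ 2.
have M20 : 0 <= M2 by apply: sumr_ge0 => i _; exact: sqr_ge0.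
(* Step length from [w] towards [p]. The linear gain is at least [s * e], the quadratic loss at most
   [s ^+ 2 * M2], and [w] is within [s ^+ 2] of the infimum; this [s] leads below the infimum by
   more than [s ^+ 2 * e]. *)
pose s : R := e / (e + 1 + M2).
have D0 : 0 < e + 1 + M2 by lra.
have s0 : 0 < s by rewrite divr_gt0.
have sE : s * (e + 1 + M2) = e by rewrite mulfVK ?gt_eqF.
have s1 : s <= 1 by rewrite ler_pdivrMr//; lra.
clearbody s.
have [_ [w Pw <-] phiw] := inf_adherent (exprn_gt0 2 s0) hA.
pose y i := b i - w i.
have [p Pp yp] := Psup y (e / 2) (divr_gt0 e0 (ltr0n _ 2)).
have Pwp : P (fun i => (1 - s) * w i + s * p i).
  by apply: Pconv => //; rewrite ltW.
have := infA _ Pwp.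
have -> : phi (fun i => (1 - s) * w i + s * p i) =
  phi w - 2 * s * (\sum_i y i * p i - \sum_i y i * w i)
  + s ^+ 2 * \sum_i (p i - w i) ^+ 2.
  rewrite /phi -sumrB !mulr_sumr -sumrB -big_split/=.
  by apply: eq_bigr => i _; rewrite /y; ring.
have pwM : \sum_i (p i - w i) ^+ 2 <= M2.
  apply: ler_sum => i _; have := PM _ Pp i; have := PM _ Pw i.
  rewrite !ler_norml => /andP[w1 w2] /andP[p1 p2].
  have : 0 <= (2 * M - (p i - w i)) * (2 * M + (p i - w i)).
    by rewrite mulr_ge0//; lra.
  by rewrite !expr2; lra.
have phiE : phi w = \sum_i y i * b i - \sum_i y i * w i.
  by rewrite -sumrB; apply: eq_bigr => i _; rewrite /y; ring.
have := phi_gt _ Pw.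
set X := \sum_i y i * p i in yp *; set Y := \sum_i y i * b i in yp phiE *.
set Z := \sum_i y i * w i in phiE *; set Q := \sum_i (p i - w i) ^+ 2 in pwM *.
move=> gte geinf.
have XZ : e / 2 <= X - Z by lra.
have : 2 * s * (e / 2) <= 2 * s * (X - Z) by rewrite ler_wpM2l//; lra.
have : s ^+ 2 * Q <= s ^+ 2 * M2 by rewrite ler_wpM2l// sqr_ge0.
have : s * (s * (e + 1 + M2)) = s * e by rewrite sE.
have : 0 < s * s * e by rewrite !mulr_gt0.
move: phiw; rewrite !expr2; lra.
Qed.

(** * Modulus, real and imaginary parts *)

Section ComplexNorm.
Context {R : realType}.
Implicit Types z : R[i].

Lemma normc_ge0 z : 0 <= normc z.
Proof. by case: z => a b; exact: sqrtr_ge0. Qed.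

Lemma normr_Re_le z : `|complex.Re z| <= normc z.
Proof. by rewrite -lecR; exact: normc_ge_Re. Qed.

Lemma normr_Im_le z : `|complex.Im z| <= normc z.
Proof.
case: z => a b /=; rewrite -sqrtr_sqr ler_wsqrtr// lerDr; exact: sqr_ge0.
Qed.

Lemma normc_le_ReIm z : normc z <= `|complex.Re z| + `|complex.Im z|.
Proof.
rewrite [z in normc z]complex.complexE (le_trans (complex.le_normcD _ _))//.
rewrite lerD//.
  by case: z => a b /=; rewrite expr0n addr0 sqrtr_sqr.
by rewrite normcM; case: z => a b /=; rewrite !expr0n/= expr1n !add0r addr0 sqrtr1 mul1r sqrtr_sqr.
Qed.

Lemma normc_real (x : R) : normc x%:C%C = `|x|.
Proof. by rewrite /= expr0n addr0 sqrtr_sqr. Qed.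

Lemma complex_Re_sum (I : Type) (r : seq I) (P : pred I) (F : I -> R[i]) :
  complex.Re (\sum_(i <- r | P i) F i) = \sum_(i <- r | P i) complex.Re (F i).
Proof. by apply: (big_morph (@complex.Re R)) => // -[a b] [c d]. Qed.

Lemma complex_Im_sum (I : Type) (r : seq I) (P : pred I) (F : I -> R[i]) :
  complex.Im (\sum_(i <- r | P i) F i) = \sum_(i <- r | P i) complex.Im (F i).
Proof. by apply: (big_morph (@complex.Im R)) => // -[a b] [c d]. Qed.

Lemma complex_ReM (z w : R[i]) : complex.Re (z * w) =
  complex.Re z * complex.Re w - complex.Im z * complex.Im w.
Proof. by case: z w => [a b] [c d]. Qed.

Lemma complex_ImM (z w : R[i]) : complex.Im (z * w) =
  complex.Re z * complex.Im w + complex.Im z * complex.Re w.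
Proof. by case: z w => [a b] [c d]. Qed.

Lemma complex_ReD (z w : R[i]) : complex.Re (z + w) = complex.Re z + complex.Re w.
Proof. by case: z w => [a b] [c d]. Qed.

Lemma complex_ImD (z w : R[i]) : complex.Im (z + w) = complex.Im z + complex.Im w.
Proof. by case: z w => [a b] [c d]. Qed.

Lemma complex_ReN z : complex.Re (- z) = - complex.Re z.
Proof. by case: z. Qed.

Lemma complex_ImN z : complex.Im (- z) = - complex.Im z.
Proof. by case: z. Qed.

Lemma normc_sum (I : Type) (r : seq I) (P : pred I) (F : I -> R[i]) :
  normc (\sum_(i <- r | P i) F i) <= \sum_(i <- r | P i) normc (F i).
Proof.
apply: (big_ind2 (fun z (x : R) => normc z <= x)) => //.
  by rewrite normc0.
by move=> z x w y zx wy; rewrite (le_trans (complex.le_normcD _ _))// lerD.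
Qed.

Lemma exists_phase z : exists2 t : R[i], normc t = 1 & t * z = (normc z)%:C%C.
Proof.
have [->|z0] := eqVneq z 0; first by exists 1; rewrite ?normc1// mulr0 normc0.
have nz : normc z != 0 by apply: contraNneq z0 => /eq0_normc ->.
exists ((normc z)%:C%C / z); last by rewrite divfK.
rewrite normcM normcV normc_real ger0_norm ?normc_ge0//.
by rewrite divff.
Qed.

End ComplexNorm.

(** * Interpolation on Sidon sets by duality *)

Lemma sum_prod_bool (V : nmodType) (I : finType) (F : I * bool -> V) :
  \sum_i F i = \sum_k (F (k, true) + F (k, false)).
Proof.
transitivity (\sum_k \sum_c F (k, c)).
  by rewrite pair_bigA; apply: eq_bigr => -[].
by apply: eq_bigr => k _; rewrite big_bool.
Qed.

(** Ensures that [sup_norm] is a genuine supremum here and not the default value of [sup]. *)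
Lemma has_sup_character_sum (R : realType) (G : topologicalZmodType) (N : nat)
 (g : 'I_N -> G -> R[i])
    (a : 'I_N -> R[i]) : (forall k x, normc (g k x) = 1) ->
  has_sup [set normc (\sum_k a k * g k x) | x in [set: G]].
Proof.
move=> g1; split; first by exists (normc (\sum_k a k * g k 0)), 0.
exists (\sum_k normc (a k)) => _ [x _ <-].
apply: (le_trans (normc_sum _ _ _)); apply: ler_sum => k _.
by rewrite normcM g1 mulr1.
Qed.

(** A list [s] of weighted points is a finitely supported measure. The transforms of measures of
    mass at most [B * S] form a bounded convex set, and the Sidon inequality says that no linear
    functional separates [b] from it. *)
Lemma sidon_interpolation (R : realType) (G : topologicalZmodType) (N : nat)
    (g : 'I_N -> G -> R[i]) (S B : R) (b : 'I_N -> R[i]) (e : R) :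
  (forall k x, normc (g k x) = 1) -> 0 <= S -> 0 <= B -> 0 < e ->
  (forall a : 'I_N -> R[i],
     \sum_k normc (a k) <= S * sup_norm (fun x => \sum_k a k * g k x)) ->
  (forall k, normc (b k) <= B) ->
  exists2 s : seq (R[i] * G), \sum_(p <- s) normc p.1 <= B * S &
    forall k, normc (\sum_(p <- s) p.1 * g k p.2 - b k) <= e.
Proof.
move=> g1 S0 B0 e0 sid bB.
have BS0 : 0 <= B * S by rewrite mulr_ge0.
(* Real coordinates of a complex vector: [true] marks real parts, [false] imaginary parts. *)
pose coord (z : 'I_N -> R[i]) (i : 'I_N * bool) : R :=
  if i.2 then complex.Re (z i.1) else complex.Im (z i.1).
pose comb (s : seq (R[i] * G)) k := \sum_(p <- s) p.1 * g k p.2.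
pose P (w : 'I_N * bool -> R) := exists2 s : seq (R[i] * G),
  \sum_(p <- s) normc p.1 <= B * S & w = coord (comb s).
have combB s k : normc (comb s k) <= \sum_(p <- s) normc p.1.
  apply: (le_trans (normc_sum _ _ _)); apply: ler_sum => p _.
  by rewrite normcM g1 mulr1.
(* An error of [e / 2] in each real coordinate gives [e] in each complex one. *)
have [w [s sBS ->] wb] : exists2 w, P w & \sum_i (coord b i - w i) ^+ 2 <= (e / 2) ^+ 2.
  apply: (@convex_approx _ _ _ _ (B * S)); last by rewrite exprn_gt0// divr_gt0.
  - exists (coord (comb [::])), [::] => //.
    by rewrite big_nil.
  - move=> _ [s sBS ->] [k []] /=; apply: le_trans sBS.
      exact: le_trans (normr_Re_le _) (combB _ _).
    exact: le_trans (normr_Im_le _) (combB _ _).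
  - move=> t _ _ /andP[t0 t1] [s1 s1B ->] [s2 s2B ->].
    (* Measures are added by concatenating their lists. *)
    exists ([seq ((1 - t)%:C%C * p.1, p.2) | p <- s1] ++
            [seq (t%:C%C * p.1, p.2) | p <- s2]).
      rewrite big_cat !big_map/=.
      under eq_bigr do rewrite normcM normc_real ger0_norm ?subr_ge0//.
      under [X in _ + X]eq_bigr do rewrite normcM normc_real ger0_norm//.
      rewrite -!mulr_sumr.
      have -> : B * S = (1 - t) * (B * S) + t * (B * S) by ring.
      by rewrite lerD// ler_wpM2l// subr_ge0.
    apply/funext => -[k c]; rewrite /coord/= /comb big_cat !big_map/=.
    under [\sum_(j <- s1) (_ * _ * _)]eq_bigr do rewrite -mulrA.
    under [\sum_(j <- s2) (_ * _ * _)]eq_bigr do rewrite -mulrA.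
    rewrite -!mulr_sumr; case: c; rewrite ?complex_ReD ?complex_ImD ?complex_ReM ?complex_ImM /=; ring.
  move=> y e' e'0.
  (* the real functional y is the real part of the complex functional a *)
  pose a k : R[i] := Complex (y (k, true)) (- y (k, false)).
  have aE (z : 'I_N -> R[i]) :
      \sum_i y i * coord z i = complex.Re (\sum_k a k * z k).
    rewrite sum_prod_bool complex_Re_sum; apply: eq_bigr => k _.
    by rewrite complex_ReM/= /coord/=; ring.
  pose A := [set normc (\sum_k a k * g k x) | x in [set: G]].
  have supA : has_sup A by exact: has_sup_character_sum.
  (* Multiplying this tolerance by [B * S] gives at most [e']; the [+ 1] covers the case
     [B * S = 0]. *)
  have e''0 : 0 < e' / (B * S + 1) by rewrite divr_gt0//; lra.
  have [_ [x _ <-] xsup] := sup_adherent e''0 supA.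
  set z := \sum_k _ in xsup.
  have [t t1 tz] := exists_phase z.
  (* A point mass using the whole budget, placed where the sup norm is nearly attained and rotated
     by [t] so that the functional takes a nonnegative real value. *)
  exists (coord (comb [:: ((B * S)%:C%C * t, x)])).
    eexists; last by [].
    by rewrite big_seq1 normcM t1 mulr1 normc_real ger0_norm.
  rewrite !aE.
  have -> : complex.Re (\sum_k a k * comb [:: ((B * S)%:C%C * t, x)] k) = B * S * normc z.
    transitivity (complex.Re ((B * S)%:C%C * (t * z))).
      congr complex.Re; rewrite !mulr_sumr; apply: eq_bigr => k _.
      by rewrite /comb big_seq1/=; ring.
    by rewrite tz complex_ReM/=; ring.
  apply: (le_trans (ler_norm _)); apply: (le_trans (normr_Re_le _)).
  apply: (le_trans (normc_sum _ _ _)).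
  apply: (@le_trans _ _ (B * \sum_k normc (a k))).
    rewrite mulr_sumr; apply: ler_sum => k _.
    by rewrite normcM mulrC ler_wpM2r// normc_ge0.
  apply: (@le_trans _ _ (B * (S * sup A))); first by rewrite ler_wpM2l.
  have : B * S * sup A <= B * S * (normc z + e' / (B * S + 1)).
    by rewrite ler_wpM2l//; lra.
  have : B * S * (e' / (B * S + 1)) <= e'.
    by rewrite mulrA ler_pdivrMr; [nra|lra].
  by lra.
exists s => // k.
have e20 : 0 <= e / 2 by rewrite divr_ge0// ltW.
have ck c : `|coord b (k, c) - coord (comb s) (k, c)| <= e / 2.
  rewrite -ler_sqr ?nnegrE// real_normK ?num_real//.
  apply: le_trans wb; rewrite (bigD1 (k, c))//= lerDl sumr_ge0// => i _.
  exact: sqr_ge0.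
apply: (le_trans (normc_le_ReIm _)).
have := ck true; have := ck false; rewrite /coord/= /comb.
rewrite complex_ReD complex_ImD complex_ReN complex_ImN [X in X <= _ -> _]distrC [X in _ -> X <= _ -> _]distrC.
by lra.
Qed.

(** * The grid in complex space and its size *)

(** Dividing row [k] by the unimodular [g k] preserves moduli and gives a matrix independent of [w].
    Complex dimension [n] is real dimension [2 * n], so the real estimate applies. *)
Lemma complex_grid_far (R : realType) (N n q : nat) (g : 'I_N -> R[i])
    (A : 'I_N -> 'I_n -> R[i])
    (z : {ffun 'I_N * bool -> 'I_q} -> 'I_N -> R[i])
    (H : {ffun 'I_N * bool -> 'I_q} -> 'I_n -> R[i]) : (0 < q)%N ->
  (192 ^ (N * 2) * q ^ (n * 2) <= q ^ (N * 2))%N ->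
  (forall k, normc (g k) = 1) ->
  (forall w k, normc (z w k - Complex (w (k, true))%:R (w (k, false))%:R)
     <= 2^-1) ->
  N%:R / 2 * q%:R ^+ (N * 2) <=
    \sum_w \sum_k normc (g k * z w k - \sum_j A k j * H w j).
Proof.
move=> q0 Hq g1 zw.
have g0 k : g k != 0.
  by apply/eqP => gk; have := g1 k; rewrite gk normc0 => /eqP; rewrite eq_sym oner_eq0.
pose A' k j := (g k)^-1 * A k j.
(* the real 2N x 2n matrix of the complex matrix A' *)
pose a (i : 'I_N * bool) (j : 'I_n * bool) : R :=
  if i.2 then if j.2 then complex.Re (A' i.1 j.1) else - complex.Im (A' i.1 j.1)
  else if j.2 then complex.Im (A' i.1 j.1) else complex.Re (A' i.1 j.1).
pose h w (j : 'I_n * bool) : R :=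
  if j.2 then complex.Re (H w j.1) else complex.Im (H w j.1).
have := @grid_far_from_span R ('I_N * bool)%type ('I_n * bool)%type q a h q0.
rewrite !card_prod !card_ord card_bool => /(_ Hq) far.
(* The modulus bounds both the real and the imaginary part, hence the factor 2; the error [2^-1] in
   [z] is paid twice, hence the term 1. *)
suff : \sum_(w : {ffun 'I_N * bool -> 'I_q})
    \sum_i `|(w i)%:R - \sum_j a i j * h w j| <=
  \sum_w \sum_k (2 * normc (g k * z w k - \sum_j A k j * H w j) + 1).
  move/(le_trans far) => {}far.
  have : N%:R * 2 * q%:R ^+ (N * 2) <=
      2 * (\sum_w \sum_k normc (g k * z w k - \sum_j A k j * H w j)) + N%:R * q%:R ^+ (N * 2).
    apply: (le_trans _ (le_trans far _)); first by rewrite natrM.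
    rewrite le_eqVlt; apply/orP; left; apply/eqP.
    under eq_bigr do rewrite big_split/= -mulr_sumr sumr_const card_ord.
    rewrite big_split/= -mulr_sumr sumr_const card_ffun card_prod card_bool !card_ord.
    by rewrite -[_ *+ (q ^ _)]mulr_natr natrX.
  by lra.
apply: ler_sum => w _; rewrite sum_prod_bool; apply: ler_sum => k _.
set u := \sum_j A k j * H w j.
have aE : Complex (\sum_j a (k, true) j * h w j) (\sum_j a (k, false) j * h w j)
    = (g k)^-1 * u.
  rewrite /u mulr_sumr.
  apply/eqP; rewrite complex.eq_complex/= complex_Re_sum complex_Im_sum !sum_prod_bool.
  by apply/andP; split; apply/eqP; apply: eq_bigr => j _;
    rewrite mulrA -/(A' k j); [rewrite complex_ReM|rewrite complex_ImM]; rewrite /a /h/=; ring.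
set c := Complex _ _ in aE.
set wc := Complex (w (k, true))%:R (w (k, false))%:R : R[i].
have : normc (wc - c) <= normc (g k * z w k - u) + 2^-1.
  have -> : normc (g k * z w k - u) = normc (z w k - c).
    rewrite -[RHS]mul1r -[in RHS](g1 k) -normcM aE; congr normc.
    by rewrite mulrBr mulrA mulfV// mul1r.
  have -> : wc - c = (z w k - c) - (z w k - wc) by ring.
  apply: (le_trans (complex.le_normcD _ _)).
  by rewrite complex.normcN lerD2l zw.
have := normr_Re_le (wc - c); have := normr_Im_le (wc - c).
rewrite complex_ReD complex_ImD complex_ReN complex_ImN /=; lra.
Qed.

(** In exponents of 192 the claim is [N <= r * (N - n)], which holds since [N - n] is at least
    [delta * N] and [delta * r] at least 1. *)
Lemma pow_grid_size (R : realType) (delta : R) (r N n : nat) :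
  1 <= delta * r%:R -> n%:R <= (1 - delta) * N%:R ->
  (192 ^ (N * 2) * (192 ^ r) ^ (n * 2) <= (192 ^ r) ^ (N * 2))%N.
Proof.
move=> dr nN; rewrite -!expnM -expnD leq_exp2l//.
rewrite -(ler_nat R) natrD !natrM.
have : 0 <= r%:R :> R by []. have : 0 <= N%:R :> R by [].
have : r%:R * n%:R <= r%:R * ((1 - delta) * N%:R) by rewrite ler_wpM2l.
have : 1 * N%:R <= delta * r%:R * N%:R by rewrite ler_wpM2r.
lra.
Qed.

(** * Borel measurability and translation invariance of the Haar integral *)

Section HaarIntegral.
Context {R : realType} {G : topologicalZmodType}.

Lemma measurable_borel_continuous (f : G -> R) :
  continuous f -> measurable_fun [set: borel G] (f : borel G -> R).
Proof.
move=> cf; apply: (measurability _ (RGenOpens.measurableE R)).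
move=> _ [_ [a [b ->] <-]]; rewrite setTI; apply: sub_sigma_algebra.
by move/continuousP: cf; apply; exact: interval_open.
Qed.

Lemma measurable_borel_addr (t : G) :
  measurable_fun [set: borel G] ((fun x => x + t) : borel G -> borel G).
Proof.
apply: (@measurability _ _ _ (borel G) _ _ (@open G)) => //.
move=> _ [U oU <-]; rewrite setTI; apply: sub_sigma_algebra.
have : continuous (fun x : G => x + t).
  by move=> x; apply: (@continuous2_cvg _ _ _ _ _ _ _ _ _ _ _ (@add_continuous G (x, t))); [exact: cvg_id|exact: cvg_cst].
by move/continuousP; apply.
Qed.

(** The preimage of [A] under translation by [t] is the translate of [A] by [- t], so the
    pushforward of [mu] is [mu]. *)
Lemma integral_haar_addr (mu : probability (borel G) R) (t : G)
    (f : borel G -> \bar R) : is_haar mu ->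
  measurable_fun [set: borel G] f -> (forall x, 0 <= f x)%E ->
  (\int[mu]_x f (x + t)%R = \int[mu]_x f x)%E.
Proof.
move=> [muT _ _] mf f0.
rewrite -[LHS](@ge0_integral_pushforward _ _ _ _ R _ (measurable_borel_addr t) mu setT f)//.
apply: eq_measure_integral; first exact: measurable_borel_addr.
move=> ? A mA _; rewrite /pushforward -[RHS](muT (- t) _ mA).
congr (mu _); apply/seteqP; split => [x xA|_ [a aA <-]].
  by exists (x + t) => //; rewrite addrCA addNr addr0.
by rewrite /preimage/= addrAC addNr add0r.
Qed.

Lemma continuous_Re (f : G -> R[i]) : continuous (f : G -> R[i]^o) ->
  continuous (fun x => complex.Re (f x)).
Proof.
move=> cf x; apply/cvgrPdist_lt => e e0.
have e0' : (0 : R[i]) < e%:C%C by rewrite complex.ltcR.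
move/cvgrPdist_lt: (cf x) => /(_ _ e0'); apply: filterS => y.
by rewrite -complex_ReN -complex_ReD -complex.ltcR; apply: le_lt_trans; exact: complex.normc_ge_Re.
Qed.

Lemma continuous_Im (f : G -> R[i]) : continuous (f : G -> R[i]^o) ->
  continuous (fun x => complex.Im (f x)).
Proof.
move=> cf x; apply/cvgrPdist_lt => e e0.
have e0' : (0 : R[i]) < e%:C%C by rewrite complex.ltcR.
move/cvgrPdist_lt: (cf x) => /(_ _ e0'); apply: filterS => y.
rewrite -complex_ImN -complex_ImD -complex.ltcR; apply: le_lt_trans.
by rewrite [in leRHS]complex.normc_def complex.lecR; case: (_ - _) => a b; exact: normr_Im_le.
Qed.

Lemma measurable_normcB (f g : borel G -> R[i]) :
  measurable_fun setT (fun x => complex.Re (f x)) ->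
  measurable_fun setT (fun x => complex.Im (f x)) ->
  measurable_fun setT (fun x => complex.Re (g x)) ->
  measurable_fun setT (fun x => complex.Im (g x)) ->
  measurable_fun setT (fun x => (normc (f x - g x))%:E).
Proof.
move=> fR fI gR gI; apply/measurable_EFinP.
rewrite (_ : (fun x => _) = Num.sqrt \o (fun x =>
  (complex.Re (f x) - complex.Re (g x)) ^+ 2 +
  (complex.Im (f x) - complex.Im (g x)) ^+ 2)).
  apply: measurableT_comp.
    by apply: continuous_measurable_fun; exact: sqrt_continuous.
  by apply: measurable_funD; apply: measurable_funX; apply: measurable_funB.
by apply/funext => x /=; case: (f x) (g x) => [a b] [c d].
Qed.

End HaarIntegral.

(** * Passing to part of a Sidon set *)

Section SidonRestriction.
Context {R : realType} {G : topologicalZmodType}.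

Lemma sidon_subset (N M : nat) (gamma : 'I_N -> G -> R[i])
    (lambda : 'I_M -> G -> R[i]) (S : R) : sidon lambda S ->
  injective gamma -> (forall k, exists j, gamma k = lambda j) ->
  forall a : 'I_N -> R[i],
    \sum_k normc (a k) <= S * sup_norm (fun x => \sum_k a k * gamma k x).
Proof.
move=> [_ _ sid] gI gl a; have [f fE] := choice gl.
have fI : injective f by move=> k l fkl; apply: gI; rewrite !fE fkl.
(* Extension of [a] by zero: by injectivity of [f] the sum has one term on the image of [f], and
   none off it. *)
pose a' j := \sum_(k | f k == j) a k.
have a'f k : a' (f k) = a k.
  by rewrite /a' (big_pred1 k)// => l; rewrite (inj_eq fI).
have -> : (fun x => \sum_k a k * gamma k x) = (fun x => \sum_j a' j * lambda j x).
  apply/funext => x; rewrite (partition_big f xpredT)//=.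
  apply: eq_bigr => j _; rewrite mulr_suml; apply: eq_bigr => k /eqP <-.
  by rewrite fE.
apply: le_trans (sid a'); rewrite [leRHS](bigID (mem (codom f)))/=.
rewrite -[leLHS]addr0 lerD//; last by apply: sumr_ge0 => j _; exact: normc_ge0.
rewrite -big_uniq /=; last by rewrite map_inj_uniq ?enum_uniq.
rewrite big_map big_enum/= le_eqVlt; apply/orP; left; apply/eqP.
by apply: eq_bigr => k _; rewrite a'f.
Qed.

(** Test with all coefficients 1: the left side is [N], and the sup norm is nonnegative. *)
Lemma sidon_constant_gt0 (N : nat) (g : 'I_N -> G -> R[i]) (S : R) :
  (0 < N)%N -> (forall k x, normc (g k x) = 1) ->
  (forall a : 'I_N -> R[i],
     \sum_k normc (a k) <= S * sup_norm (fun x => \sum_k a k * g k x)) ->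
  0 < S.
Proof.
move=> N0 g1 /(_ (fun=> 1)); rewrite normc1 sumr_const card_ord => sid.
have sup0 : 0 <= sup_norm (fun x => \sum_k (fun=> 1) k * g k x).
  have [_ ub] := has_sup_character_sum (fun=> 1) g1.
  apply: le_trans (ub_le_sup ub _); last by exists 0.
  exact: normc_ge0.
rewrite ltNge; apply/negP => S0.
have := le_trans sid (mulr_le0_ge0 S0 sup0).
by rewrite leNgt ltr0n N0.
Qed.

End SidonRestriction.

(** * Averaging over the grid and integrating over the group *)

(** Multiplicativity turns the combination of the translates of [gamma k] into [gamma k x] times the
    interpolated value. The approximants become vectors in the range of [A], which depends on
    neither [w] nor [x]. *)
Lemma translates_far (R : realType) (G : topologicalZmodType) (N n q : nat)
    (gamma : 'I_N -> G -> R[i]) (b : 'I_n -> G -> R[i])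
    (A : 'I_N -> 'I_n -> R[i])
    (s : {ffun 'I_N * bool -> 'I_q} -> seq (R[i] * G)) (x : G) :
  (0 < q)%N -> (192 ^ (N * 2) * q ^ (n * 2) <= q ^ (N * 2))%N ->
  (forall k, character (gamma k)) ->
  (forall w k, normc (\sum_(p <- s w) p.1 * gamma k p.2 -
     Complex (w (k, true))%:R (w (k, false))%:R) <= 2^-1) ->
  N%:R / 2 * q%:R ^+ (N * 2) <=
    \sum_w \sum_k \sum_(p <- s w) normc p.1 *
      normc (gamma k (x + p.2) - \sum_j A k j * b j (x + p.2)).
Proof.
move=> q0 Hq cg sw.
have g1 k : normc (gamma k x) = 1 by have [_ + _] := cg k; apply.
apply: (le_trans (complex_grid_far A
  (fun w j => \sum_(p <- s w) p.1 * b j (x + p.2)) q0 Hq g1 sw)).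
apply: ler_sum => w _; apply: ler_sum => k _.
have -> : gamma k x * (\sum_(p <- s w) p.1 * gamma k p.2) -
      \sum_j A k j * (\sum_(p <- s w) p.1 * b j (x + p.2)) =
    \sum_(p <- s w) p.1 * (gamma k (x + p.2) - \sum_j A k j * b j (x + p.2)).
  under [X in _ - X]eq_bigr do rewrite mulr_sumr.
  rewrite exchange_big/= mulr_sumr -sumrB; apply: eq_bigr => p _.
  have [_ _ ->] := cg k; rewrite mulrBr mulr_sumr mulrCA; congr (_ - _).
  by apply: eq_bigr => j _; rewrite mulrCA.
apply: (le_trans (normc_sum _ _ _)).
by under eq_bigr do rewrite normcM.
Qed.

Theorem theorem1p2 (R : realType) (delta : R) (hdelta : 0 < delta < 1) :
  exists c : R, 0 < c /\
    forall (G : topologicalZmodType) (mu : probability (borel G) R)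
      (N M : nat) (gamma : 'I_N -> G -> R[i])
      (lambda : 'I_M -> G -> R[i]) (S : R) (n : nat),
      compact [set: G] -> hausdorff_space G -> is_haar mu ->
      (0 < N)%N -> injective gamma ->
      sidon lambda S -> (forall k, exists j, gamma k = lambda j) ->
      n%:R <= (1 - delta) * N%:R ->
      ((c / S)%:E <= kolmogorov_width mu n gamma)%E.
Proof.
have /andP[d0 d1] := hdelta.
pose r := Num.bound (delta^-1).
have dr : 1 <= delta * r%:R.
  by rewrite mulrC -ler_pdivrMr// div1r ltW// archi_boundP// invr_ge0 ltW.
pose q := (192 ^ r)%N.
have q0 : (0 < q)%N by rewrite expn_gt0.
have q0R : 0 < q%:R :> R by rewrite ltr0n.
(* Interpolating measures will have mass at most [2 * q * S]; times an error [c / S] this is [1/4]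
   for each pair of [w] and [k], half of the lower bound [1/2]. *)
exists (8 * q%:R)^-1; split; first by rewrite invr_gt0 mulr_gt0.
move=> G mu N M gamma lambda S n _ _ haar N0 gI sid gl nN.
have Hq : (192 ^ (N * 2) * q ^ (n * 2) <= q ^ (N * 2))%N.
  exact: pow_grid_size dr nN.
have cg k : character (gamma k) by have [j ->] := gl k; have [+ _ _] := sid.
have g1 k x : normc (gamma k x) = 1 by have [_ + _] := cg k; apply.
have gsid := sidon_subset sid gI gl.
have S0 := sidon_constant_gt0 N0 g1 gsid.
apply/ereal_infP => _ [V [[VL1 V0 Vlin] [b [Vb Vspan]]] <-].
rewrite leNgt; apply/negP => lt_c.
have Vsum (A : 'I_n -> R[i]) : V (fun x => \sum_j A j * b j x).
  elim: (index_enum _) => [|j l IHl].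
    by under eq_fun do rewrite big_nil.
  by under eq_fun do rewrite big_cons; exact: Vlin.
have mV v : V v -> measurable_fun [set: borel G] (fun x => complex.Re (v x))
    /\ measurable_fun [set: borel G] (fun x => complex.Im (v x)).
  by move=> /VL1[vR vI]; split; apply/measurable_EFinP;
    [exact: measurable_int vR|exact: measurable_int vI].
have mgB k v : V v ->
    measurable_fun [set: borel G] (fun x => (normc (gamma k x - v x))%:E).
  move=> /mV[vR vI]; have [cgk _ _] := cg k.
  by apply: measurable_normcB => //; apply: measurable_borel_continuous;
    [exact: continuous_Re|exact: continuous_Im].
have approx k : exists A : 'I_n -> R[i],
    (L1_norm mu (fun x => gamma k x - \sum_j A j * b j x)%R <
     ((8 * q%:R)^-1 / S)%:E)%E.
  (* Take an element of [V] this close to [gamma k] and replace it by its almost everywhere equal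
     combination of the [b j]; [L1_norm] is unchanged. *)
  have := le_lt_trans (le_bigmax _ (fun k => L1_dist mu (gamma k) V) k) lt_c.
  move/ereal_inf_lt => [_ [v Vv <-] vlt].
  have [A vA] := Vspan _ Vv; exists A; apply: le_lt_trans vlt.
  rewrite le_eqVlt; apply/orP; left; apply/eqP.
  apply: ge0_ae_eq_integral => //.
  - exact: mgB.
  - exact: mgB.
  - by move=> x _; rewrite lee_fin normc_ge0.
  - by move=> x _; rewrite lee_fin normc_ge0.
  - case: vA => Z [mZ Z0 sub]; exists Z; split=> // x /= nx.
    by apply: sub => /= vx; apply: nx => _; rewrite vx.
have [A AP] := choice approx.
pose h k x : R := normc (gamma k x - \sum_j A k j * b j x).
have h0 k x : (0 <= (h k x)%:E)%E by rewrite lee_fin normc_ge0.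
have mh k : measurable_fun [set: borel G] (fun x => (h k x)%:E) by exact: mgB.
have interp (w : {ffun 'I_N * bool -> 'I_q}) : exists s : seq (R[i] * G),
    \sum_(p <- s) normc p.1 <= 2 * q%:R * S /\
    forall k, normc (\sum_(p <- s) p.1 * gamma k p.2 -
      Complex (w (k, true))%:R (w (k, false))%:R) <= 2^-1.
  (* Both parts of a grid point are at most [q], so its modulus is at most [2 * q]. *)
  have B0 : 0 <= 2 * q%:R :> R by rewrite mulr_ge0// ltW.
  have e0 : 0 < 2^-1 :> R by rewrite invr_gt0.
  have wB k : normc (Complex (w (k, true))%:R (w (k, false))%:R : R[i]) <=
      2 * q%:R.
    apply: (le_trans (normc_le_ReIm _)) => /=; rewrite !normr_nat.
    have wq c : (w (k, c))%:R <= q%:R :> R by rewrite ler_nat ltnW.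
    by rewrite mulr_natl mulr2n lerD.
  have [s sS sb] := sidon_interpolation g1 (ltW S0) B0 e0 gsid wB.
  by exists s.
have [s sP] := choice interp.
(* Total error at the translates of [x], weighted by mass. It is bounded below at every [x], while
   by invariance its integral involves only the norms of the untranslated errors. *)
pose F x := (\sum_w \sum_k \sum_(p <- s w)
  (normc p.1)%:E * (h k (x + p.2)%R)%:E)%E.
have mht k t : measurable_fun [set: borel G] (fun x => (h k (x + t))%:E).
  exact: measurableT_comp (mh k) (measurable_borel_addr t).
have mterm k p : measurable_fun [set: borel G]
    (fun x => ((normc p.1)%:E * (h k (x + p.2)%R)%:E)%E).
  by apply: measurable_funeM; exact: mht.
have term0 k (p : R[i] * G) x :
    (0 <= (normc p.1)%:E * (h k (x + p.2)%R)%:E)%E.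
  by rewrite mule_ge0// lee_fin normc_ge0.
have F_ge (x : G) : ((N%:R / 2 * q%:R ^+ (N * 2))%:E <= F x)%E.
  have far := translates_far b A x q0 Hq cg (fun w => (sP w).2).
  apply: (@le_trans _ _ (_%:E)); first by rewrite lee_fin; exact: far.
  rewrite /F -sumEFin; under eq_bigr do rewrite -sumEFin.
  by under eq_bigr do under eq_bigr do rewrite -sumEFin.
have intF : (\int[mu]_x F x = \sum_w \sum_k \sum_(p <- s w)
    (normc p.1)%:E * L1_norm mu (fun x => gamma k x - \sum_j A k j * b j x)%R)%E.
  rewrite ge0_integral_sum//; last 2 first.
  - by move=> w; do 2 apply: emeasurable_sum => ?.
  - by move=> w x _; do 2 apply: sume_ge0 => ? _.
  apply: eq_bigr => w _; rewrite ge0_integral_sum//; last 2 first.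
  - by move=> k; apply: emeasurable_sum => ?.
  - by move=> k x _; apply: sume_ge0 => ? _.
  apply: eq_bigr => k _; rewrite ge0_integral_sum//.
  apply: eq_bigr => p _; rewrite ge0_integralZl//; last by rewrite lee_fin normc_ge0.
  by rewrite (integral_haar_addr p.2 haar (mh k)).
have : (\int[mu]_x (cst (N%:R / 2 * q%:R ^+ (N * 2))%:E) x <= \int[mu]_x F x)%E.
  apply: ge0_le_integral => //.
  - by move=> x _; rewrite lee_fin mulr_ge0// ?exprn_ge0// divr_ge0.
  - by do 3 apply: emeasurable_sum => ?.
rewrite integral_cst// [X in (_ * X)%E](_ : _ = 1%E); last exact: (probability_setT mu).
rewrite mule1 intF; apply/negP; rewrite -ltNge.
(* The integral is at most [N * q ^+ (N * 2) / 4], strictly below the lower bound because [N] and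
   [q] are positive. *)
apply: (@le_lt_trans _ _ (\sum_(w : {ffun 'I_N * bool -> 'I_q}) \sum_(k < N)
   \sum_(p <- s w) (normc p.1)%:E * ((8 * q%:R)^-1 / S)%:E)%E).
  apply: lee_sum => w _; apply: lee_sum => k _; apply: lee_sum => p _.
  by rewrite lee_wpmul2l ?lee_fin ?normc_ge0// ltW.
apply: (@le_lt_trans _ _ (\sum_(w : {ffun 'I_N * bool -> 'I_q}) \sum_(k < N)
   (4^-1)%:E)%E).
  apply: lee_sum => w _; apply: lee_sum => k _.
  rewrite -ge0_sume_distrl; last by move=> p _; rewrite lee_fin normc_ge0.
  rewrite sumEFin -EFinM lee_fin.
  apply: (@le_trans _ _ (2 * q%:R * S * ((8 * q%:R)^-1 / S))).
    rewrite ler_wpM2r ?(sP w).1//.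
    by rewrite divr_ge0 ?invr_ge0 ?mulr_ge0// ltW.
  have : q%:R != 0 :> R by rewrite gt_eqF.
  have : S != 0 by rewrite gt_eqF.
  move=> Sn qn; rewrite le_eqVlt; apply/orP; left; apply/eqP.
  by field; rewrite Sn qn.
under eq_bigr do rewrite sumEFin.
rewrite sumEFin lte_fin !sumr_const card_ffun card_prod card_bool !card_ord.
rewrite -mulrnA -[X in X < _]mulr_natr natrM natrX.
have : 0 < N%:R * q%:R ^+ (N * 2) :> R by rewrite mulr_gt0 ?exprn_gt0// ltr0n.
lra.
Qed.
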